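(* Let $P:\mathbb{R}^n\to\mathbb{R}$ be a homogeneous real polynomial of degree $k$ that is symmetric and hyperbolic with respect to $\mathbf{1}=(1,\dots,1)$, with hyperbolicity cone $\Gamma(P)$ with respect to $\mathbf{1}$. Let $A$ be an $n\times n$ complex matrix with eigenvalues $\lambda(A)=(\lambda_1(A),\dots,\lambda_n(A))$, let $\Re\lambda(A)=(\Re\lambda_1(A),\dots,\Re\lambda_n(A))$, and let $\mathcal{H}(A)=(A+A^* )/2$ be the Hermitian part of $A$. If $\lambda(\mathcal{H}(A))\in\Gamma(P)$, then $$\Re\lambda(A)\in\Gamma(P)\quad\text{and}\quad P(\Re\lambda(A))\ge P(\lambda(\mathcal{H}(A))).$$
   Context: Eigenvalues are listed with (algebraic) multiplicity; the order is immaterial because $P$ is symmetric. A polynomial $P:\mathbb{R}^n\to\mathbb{R}$ is symmetric if $P(\sigma x)=P(x)$ for every permutation $\sigma$ of the coordinates and every $x\in\mathbb{R}^n$. A homogeneous real polynomial $P$ of degree $k$ on $\mathbb{R}^n$ is hyperbolic with respect to $a\in\mathbb{R}^n$ if $P(a)>0$ and, for every $x\in\mathbb{R}^n$, the univariate polynomial $t\mapsto P(ta+x)$ has only real zeros. In that case $P(ta+x)=P(a)\prod_{i=1}^k(t+\lambda_i(P;a,x))$ with real numbers $\lambda_i(P;a,x)$. The hyperbolicity cone is $\Gamma(P;a)=\{x\in\mathbb{R}^n:\lambda_i(P;a,x)>0\text{ for all }i=1,\dots,k\}$, and $\Gamma(P):=\Gamma(P;\mathbf{1})$. *)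

(* Defs.v *)
From HB Require Import structures.
From mathcomp Require Import all_boot all_order all_fingroup all_algebra.
From mathcomp Require Import reals complex mpoly.

Set Implicit Arguments.
Unset Strict Implicit.
Unset Printing Implicit Defensive.

Import GRing.Theory Num.Theory.

Local Open Scope ring_scope.
Local Open Scope complex_scope.
Local Open Scope sesquilinear_scope.

(* Vectors of R^n are functions 'I_n -> R, as expected by meval (P.@[x]). *)

Definition ones {R : realType} {n : nat} : 'I_n -> R := fun=> 1.

Definition symmetric_fun {R : realType} {n : nat} (P : {mpoly R[n]}) : Prop :=
  forall (s : 'S_n) (x : 'I_n -> R), P.@[fun i => x (s i)] = P.@[x].

(* The univariate polynomial P(a X + x); see line_polyE. *)
Definition line_poly {R : realType} {n : nat} (P : {mpoly R[n]})
    (a x : 'I_n -> R) : {poly R} :=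
  mmap polyC (fun i => a i *: 'X + (x i)%:P) P.

Lemma line_polyE (R : realType) (n : nat) (P : {mpoly R[n]})
    (a x : 'I_n -> R) (t : R) :
  (line_poly P a x).[t] = P.@[fun i => t * a i + x i].
Proof.
rewrite /line_poly /mmap mevalE horner_sum; apply: eq_bigr => m _.
rewrite hornerM hornerC /mmap1 horner_prod; congr (_ * _).
by apply: eq_bigr => i _; rewrite horner_exp !hornerE mulrC.
Qed.

(* Homogeneity of P is a separate hypothesis.  "Only real zeros" refers to
   the complex zeros of the polynomial. *)
Definition hyperbolic {R : realType} {n : nat} (P : {mpoly R[n]})
    (a : 'I_n -> R) : Prop :=
  0 < P.@[a] /\
  forall (x : 'I_n -> R) (z : R[i]),
    root (map_poly (real_complex R) (line_poly P a x)) z -> complex.Im z = 0.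

(* lam lists, with multiplicity, the k numbers lambda_i(P;a,x), that is, the
   opposites of the zeros of t |-> P(ta + x). *)
Definition hyp_eigenvalues {R : realType} {n : nat} (k : nat)
    (P : {mpoly R[n]}) (a x : 'I_n -> R) (lam : 'I_k -> R) : Prop :=
  line_poly P a x = P.@[a] *: \prod_(i < k) ('X + (lam i)%:P).

(* The list lam is unique up to order, so the existential quantifier does not
   depend on a choice. *)
Definition hyp_cone {R : realType} {n : nat} (k : nat) (P : {mpoly R[n]})
    (a x : 'I_n -> R) : Prop :=
  exists lam : 'I_k -> R,
    hyp_eigenvalues P a x lam /\ forall i, 0 < lam i.

(* lam lists the eigenvalues of A with algebraic multiplicity. *)
Definition eigenvalues {R : realType} {n : nat} (A : 'M[R[i]]_n)
    (lam : 'I_n -> R[i]) : Prop :=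
  char_poly A = \prod_(i < n) ('X - (lam i)%:P).

Definition hermitian_part {R : realType} {n : nat} (A : 'M[R[i]]_n) :
    'M[R[i]]_n :=
  2^-1 *: (A + A ^t*).

(* The eigenvalues of a Hermitian part can be listed as real numbers. *)
Lemma hermitian_part_eigenvalues (R : realType) (n : nat) (A : 'M[R[i]]_n) :
  exists mu : 'I_n -> R, eigenvalues (hermitian_part A) (fun i => (mu i)%:C).
Proof.
set H := hermitian_part A.
have hH : H \is hermsymmx.
  apply/is_hermitianmxP; rewrite expr0 scale1r /H /hermitian_part.
  apply/matrixP => i j; rewrite !mxE rmorphM rmorphD /= conjCK.
  by rewrite fmorphV rmorph_nat addrC.
have Pu := spectral_unit H; set P := spectralmx H in Pu *.
have HE : H = invmx P *m diag_mx (spectral_diag H) *m P.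
  exact/orthomx_spectralP/hermitian_normalmx.
have dR i : (complex.Re (spectral_diag H 0 i))%:C = spectral_diag H 0 i.
  by apply: RRe_real; apply: (mxOverP (hermitian_spectral_diag_real hH)).
exists (fun i => complex.Re (spectral_diag H 0 i)); rewrite /eigenvalues.
under eq_bigr => i _ do rewrite dR.
set D := diag_mx _ in HE; have -> : char_poly H = char_poly D.
  pose Q := map_mx (@polyC R[i]) P.
  have QV : map_mx (@polyC R[i]) (invmx P) *m Q = 1%:M.
    by rewrite -map_mxM mulVmx // map_mx1.
  rewrite /char_poly /char_poly_mx HE !map_mxM -/Q.
  set Q' := map_mx _ (invmx P) in QV *; set D' := map_mx _ D.
  have -> : 'X%:M - Q' *m D' *m Q = Q' *m ('X%:M - D') *m Q.
    by rewrite mulmxBr mulmxBl scalar_mxC -(mulmxA _ Q' Q) QV mulmx1.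
  by rewrite !det_mulmx mulrAC -det_mulmx QV det1 mul1r.
rewrite char_poly_trig; last exact: diag_mx_is_trig.
by apply: eq_bigr => i _; rewrite mxE eqxx mulr1n.
Qed.

(* Main.v *)
Require Import Defs.
From HB Require Import structures.
From mathcomp Require Import all_boot all_order all_fingroup all_algebra.
From mathcomp Require Import reals complex mpoly.
From mathcomp Require classical_sets.
From mathcomp Require Import lra ring zify.

(** The theorem combines two facts.

    The first is a majorization.  Triangularize [A] by a unitary matrix, so
    that the diagonal entries of the triangular form are the eigenvalues of
    [A].  The real parts of these entries form the diagonal of the Hermitian
    part of [A] in the same orthonormal basis.  In a basis diagonalizing the
    Hermitian part, with [W] the unitary change of basis, the [i]-th diagonal
    entry is the sum over [j] of |W i j|^2 times the [j]-th eigenvalue of the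
    Hermitian part.  The matrix of the numbers |W i j|^2 is doubly stochastic
    (Re_eigenvalues_doubly_stochastic).  By the argument of Hardy, Littlewood
    and Polya, the image of a vector under a doubly stochastic matrix is
    reached by finitely many steps, each of which averages a vector with a
    copy of itself in which two coordinates are exchanged
    (averaging_closed_doubly_stochastic).

    The second is that such an averaging step stays in the cone and does not
    decrease [P] (symmetric_average_ge).  Let [z] be in the cone, and let [w]
    be [z] with two coordinates exchanged.  Garding's theory shows that [P] is
    hyperbolic in the direction [z], and that the zeros of P(s z + w) are
    negative, say - mu_i.  Then P(p z + q w) = P(z) prod_i (p + q mu_i), and
    prod_i mu_i = P(w) / P(z) = 1 since [P] is symmetric.  Symmetry also gives
    P(p z + q w) = P(q z + p w), so that, when p + q = 1, the square of this
    value is P(z)^2 times the product of the factors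
    (p + q mu_i) (q + p mu_i) >= mu_i, hence at least P(z)^2.  This is
    the case of the concavity of P^(1/k) that an averaging step requires.

    Garding's theory rests on one continuity argument (upper_free_persists).
    Consider a family of complex polynomials with a fixed degree and leading
    coefficient, depending continuously on r in [0, 1].  If no member has a
    real zero and the member at r = 0 has no zero in the upper half-plane,
    then the same holds at r = 1.  It is applied to
    s |-> P(s b + i a + r x), which gives hyperbolicity in every direction [b]
    of the cone once the multiple of [a] tends to 0 (real_rooted_cone), and
    then to
    s |-> P(- i s b + (1 - r) a + r x), which shows that P(s b + x) <> 0 for
    Re s >= 0 when both [b] and [x] lie in the cone (cone_combination_free). *)

Set Implicit Arguments.
Unset Strict Implicit.
Unset Printing Implicit Defensive.

Import Order.TTheory GRing.Theory Num.Theory.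

Local Open Scope ring_scope.
Local Open Scope complex_scope.

(** * Doubly stochastic images as iterated averages *)

Section Majorization.
Variables (R : realType) (n : nat).
Implicit Types x y : 'I_n -> R.

Definition decreasing x := forall i j : 'I_n, (i <= j)%N -> x j <= x i.

(** Vectors are functions, so [K] is required to respect pointwise equality. *)
Record averaging_closed (K : ('I_n -> R) -> Prop) : Prop := AveragingClosed {
  avg_ext : forall x y, x =1 y -> K x -> K y;
  avg_perm : forall (s : 'S_n) x, K x -> K (fun i => x (s i));
  avg_tperm : forall (i j : 'I_n) (c : R) x, 0 <= c <= 1 ->
    K x -> K (fun l => (1 - c) * x l + c * x (tperm i j l)) }.

(** The new vector is an average of [x] and its transposed copy, the latter
    with weight [d / (x a - x b)]. *)
Lemma averaging_closed_transfer K x (a b : 'I_n) (d : R) :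
  averaging_closed K -> a != b -> 0 <= d -> d < x a - x b -> K x ->
  K (fun i => x i - d *+ (i == a) + d *+ (i == b)).
Proof.
move=> Kavg ab d0 dlt Kx.
have gap : 0 < x a - x b by apply: le_lt_trans dlt.
have c01 : 0 <= d / (x a - x b) <= 1.
  by rewrite divr_ge0 ?(ltW gap) //= ler_pdivrMr // mul1r ltW.
apply: (avg_ext Kavg) (avg_tperm Kavg a b c01 Kx) => i.
have E : d / (x a - x b) * (x a - x b) = d by rewrite divfK // gt_eqF.
set c := d / _ in E *; rewrite -E.
case: tpermP => [->|->|/eqP ia /eqP ib].
- by rewrite eqxx (negPf ab) mulr0n mulr1n; ring.
- by rewrite eqxx eq_sym (negPf ab) mulr0n mulr1n; ring.
- by rewrite (negPf ia) (negPf ib) !mulr0n; ring.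
Qed.

(** Each step makes one more coordinate of [x] agree with [y].  Let [b] be the
    first coordinate at which [x] is below [y]; domination of the partial sum
    up to [b] provides an earlier [a] at which [x] is above [y].  The transfer
    from [a] to [b] of the largest amount that overshoots neither target is an
    averaging step, because [x a > y a >= y b > x b].  Before [b] the new
    vector is still at least [y], so its partial sums dominate those of [y].
    Only [y] has to be sorted, so [x] may leave the sorted order along the
    way. *)
Lemma averaging_closed_dominated K x y :
  averaging_closed K -> decreasing y ->
  (forall m : nat, (m <= n)%N ->
     \sum_(i < n | (i < m)%N) y i <= \sum_(i < n | (i < m)%N) x i) ->
  \sum_i y i = \sum_i x i -> K x -> K y.
Proof.
move=> Kavg ydec; have [N] := ubnP #|[pred i | x i != y i]|.
elim: N x => // N IH x; rewrite ltnS => cardN dom tot Kx.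
case: (pickP [pred b | x b < y b]) => [b0 /= xb0|noless]; last first.
  apply: (avg_ext Kavg) Kx => i; apply/eqP; rewrite -subr_eq0.
  have : \sum_i (x i - y i) == 0 by rewrite sumrB tot subrr.
  rewrite psumr_eq0; first by move/allP/(_ i); rewrite mem_index_enum; apply.
  by move=> j _; rewrite subr_ge0 leNgt (negbT (noless j)).
pose b := [arg min_(i < b0 | x i < y i) i].
have [xb bmin] : x b < y b /\ forall i : 'I_n, (i < b)%N -> y i <= x i.
  rewrite /b; case: arg_minnP => // j xj jmin; split=> // i ij.
  by rewrite leNgt; apply/negP => /jmin; rewrite leqNgt ij.
have [a /= /andP[ab ya]] : exists a : 'I_n, (a < b)%N && (y a < x a).
  case: (pickP [pred a : 'I_n | (a < b)%N && (y a < x a)]) => [a /= ha|none].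
    by exists a.
  have := dom _ (ltn_ord b); rewrite leNgt => /negP[].
  rewrite (bigD1 b) ?ltnSn //= [ltRHS](bigD1 b) ?ltnSn //=.
  apply: ltr_leD => //; apply: ler_sum => i /andP[ib nib].
  have {}ib : (i < b)%N by rewrite ltn_neqAle nib -ltnS.
  by have /negbT := none i; rewrite /= ib /= -leNgt.
have yab : y b <= y a by apply: ydec; apply: ltnW.
pose d := Num.min (x a - y a) (y b - x b).
have d0 : 0 < d by rewrite /d lt_min !subr_gt0 ya xb.
have [da db] : d <= x a - y a /\ d <= y b - x b.
  by rewrite /d !ge_min !lexx orbT.
have neq : a != b by rewrite -val_eqE ltn_eqF.
have dgap : d < x a - x b by lra.
pose x' i := x i - d *+ (i == a) + d *+ (i == b).
have x'E m : \sum_(i < n | (i < m)%N) x' i =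
    \sum_(i < n | (i < m)%N) x i - d *+ (a < m)%N + d *+ (b < m)%N.
  rewrite big_split sumrB /=; congr (_ - _ + _).
  - case: ltnP => am.
      rewrite (bigD1 a) //= eqxx big1 ?addr0 // => i /andP[_ ia].
      by rewrite (negPf ia).
    by rewrite big1 // => i im; case: eqP => // ia; move: im; rewrite ia ltnNge am.
  - case: ltnP => bm.
      rewrite (bigD1 b) //= eqxx big1 ?addr0 // => i /andP[_ ib].
      by rewrite (negPf ib).
    by rewrite big1 // => i im; case: eqP => // ib; move: im; rewrite ib ltnNge bm.
apply: (IH x'); last by apply: averaging_closed_transfer => //; apply: ltW.
- apply: leq_trans cardN; apply: proper_card; apply/properP; split.
    apply/subsetP => i; rewrite !inE; apply: contra_neq => xy.
    rewrite /x'; case: eqP => [ia|_].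
      by move: ya; rewrite -ia xy ltxx.
    case: eqP => [ib|_]; first by move: xb; rewrite -ib xy ltxx.
    by rewrite !mulr0n subr0 addr0.
  have [dE|dE] : d = x a - y a \/ d = y b - x b.
    by rewrite /d minEle; case: ifP; [left|right].
  + exists a; rewrite !inE ?(gt_eqF ya) //= /x' eqxx (negPf neq) dE.
    by rewrite mulr1n mulr0n; apply/negPn/eqP; ring.
  + exists b; rewrite !inE ?(lt_eqF xb) //= /x' eqxx (eq_sym b) (negPf neq) dE.
    by rewrite mulr1n mulr0n; apply/negPn/eqP; ring.
- move=> m mn; rewrite x'E; case: (ltnP b m) => bm.
    by rewrite (ltn_trans ab bm) !mulr1n subrK dom.
  rewrite mulr0n addr0; case: (ltnP a m) => am; last by rewrite mulr0n subr0 dom.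
  rewrite (bigD1 a) //= [leRHS](_ : _ = (x a - d) +
     \sum_(i < n | (i < m)%N && (i != a)) x i); last first.
    by rewrite [in LHS](bigD1 a) //= mulr1n addrAC.
  apply: lerD; first by lra.
  by apply: ler_sum => i /andP[im _]; apply: bmin; apply: leq_trans bm.
- rewrite big_split sumrB /= tot -[LHS]subr0 -addrA; congr (_ + _).
  rewrite (bigD1 a) //= eqxx big1 => [|i /negPf -> //].
  rewrite (bigD1 b) //= eqxx big1 => [|i /negPf -> //].
  by rewrite !addr0 addNr oppr0.
Qed.

(** Let [p] separate the first [m] values from the others.  Replacing [x] by
    [x - p] changes both sides by [m p], and then every term of the difference
    is a product of two factors of the same sign. *)
Lemma weighted_sum_le_head x (w : 'I_n -> R) (m : nat) :
  decreasing x -> (m <= n)%N -> (forall j, 0 <= w j <= 1) ->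
  \sum_j w j = m%:R -> \sum_j w j * x j <= \sum_(j < n | (j < m)%N) x j.
Proof.
move=> xdec mn w01 wm.
(* [x m] separates; when m = n the last value of [x] does. *)
have [p [phi plo]] : exists p, (forall j : 'I_n, (j < m)%N -> p <= x j) /\
                               (forall j : 'I_n, (m <= j)%N -> x j <= p).
  move: mn; rewrite leq_eqVlt => /predU1P[mn|mn].
    case: (pickP (fun j : 'I_n => j.+1 == n)) => [l /eqP ln|none].
      exists (x l); split=> j; last by rewrite mn leqNgt ltn_ord.
      by move=> _; apply: xdec; rewrite -ltnS ln.
    exists 0; split=> j; last by rewrite mn leqNgt ltn_ord.
    have n0 : (0 < n)%N := leq_ltn_trans (leq0n j) (ltn_ord j).
    have l : (n.-1 < n)%N by rewrite ltn_predL.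
    by have := none (Ordinal l); rewrite /= prednK // eqxx.
  by exists (x (Ordinal mn)); split=> j jm; apply: xdec => //=; apply: ltnW.
rewrite -subr_ge0 [X in X - _]big_mkcond /= -sumrB.
have -> : \sum_(j < n) ((if (j < m)%N then x j else 0) - w j * x j) =
          \sum_(j < n) ((j < m)%N%:R - w j) * (x j - p).
  have -> : \sum_(j < n) ((j < m)%N%:R - w j) * (x j - p) =
     \sum_(j < n) ((if (j < m)%N then x j else 0) - w j * x j) -
     (\sum_(j < n) (j < m)%N%:R - \sum_j w j) * p.
    rewrite -sumrB mulr_suml -sumrB; apply: eq_bigr => j _.
    by case: ifP => _; rewrite ?mulr0n ?mulr1n; ring.
  have -> : \sum_(j < n) (j < m)%N%:R = m%:R :> R.
    rewrite -natr_sum -[X in X%:R]big_mkcond /= (big_ord_narrow mn).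
    by rewrite sum_nat_const card_ord muln1.
  by rewrite wm subrr mul0r subr0.
apply: sumr_ge0 => j _; have /andP[w0 w1] := w01 j.
case: ltnP => jm; first by apply: mulr_ge0; rewrite subr_ge0 ?phi.
by rewrite sub0r mulNr -mulrN; apply: mulr_ge0; rewrite // oppr_ge0 subr_le0 plo.
Qed.

Lemma sum_perm x (s : 'S_n) : \sum_i x (s i) = \sum_i x i.
Proof. by rewrite [RHS](reindex_inj (@perm_inj _ s)). Qed.

Lemma decreasing_rearrangement x : exists s : 'S_n, decreasing (fun i => x (s i)).
Proof.
pose t := [tuple x i | i < n].
have /tuple_permP[s ts] : perm_eq (sort_tuple >=%R t) t by rewrite perm_sort.
exists s => i j ij; have X l : x (s l) = (sort >=%R t)`_l.
  by rewrite ts -tnth_nth !tnth_mktuple.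
rewrite !X; have geT : total (>=%R : rel R) by move=> u v; apply: ge_total.
have getr : transitive (>=%R : rel R) by move=> u v w /[swap]; apply: le_trans.
apply: (sorted_leq_nth getr _ 0 (sort_sorted geT t)) ij;
  rewrite ?inE ?size_sort ?size_tuple //.
by move=> u; apply: lexx.
Qed.

(** After sorting both vectors, the sum of the first [m] entries of [y] is a
    weighted sum of the entries of [x]; the weights are partial column sums,
    lie in [0, 1] and have total [m]. *)
Lemma averaging_closed_doubly_stochastic K (D : 'I_n -> 'I_n -> R) x y :
  averaging_closed K -> (forall i j, 0 <= D i j) ->
  (forall i, \sum_j D i j = 1) -> (forall j, \sum_i D i j = 1) ->
  (forall i, y i = \sum_j D i j * x j) -> K x -> K y.
Proof.
move=> Kavg D0 Drow Dcol yE Kx.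
have [s sdec] := decreasing_rearrangement x.
have [r rdec] := decreasing_rearrangement y.
apply: (avg_ext Kavg (x := fun i => y (r (r^-1%g i)))) => [i|].
  by rewrite permKV.
apply: (avg_perm Kavg (r^-1)%g (x := fun i => y (r i))).
apply: averaging_closed_dominated (avg_perm Kavg s Kx) => // [m mn|].
- pose w j := \sum_(i < n | (i < m)%N) D (r i) j.
  have wx : \sum_(i < n | (i < m)%N) y (r i) = \sum_j w (s j) * x (s j).
    under eq_bigr => i _ do rewrite yE (reindex_inj (@perm_inj _ s)) /=.
    rewrite exchange_big /=.
    by apply: eq_bigr => j _; rewrite /w mulr_suml.
  rewrite wx; apply: weighted_sum_le_head => // [j|].
    rewrite sumr_ge0 //= -(Dcol (s j)) -(sum_perm (D^~ (s j)) r).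
    by rewrite /w big_mkcond /=; apply: ler_sum => i _; case: ifP.
  rewrite (sum_perm w s) exchange_big /=.
  under eq_bigr => i _ do rewrite Drow.
  by rewrite (big_ord_narrow mn) sumr_const card_ord.
- rewrite (sum_perm y r) (sum_perm x s).
  under eq_bigr => i _ do rewrite yE.
  rewrite exchange_big /=; apply: eq_bigr => j _.
  by rewrite -mulr_suml Dcol mul1r.
Qed.
End Majorization.

(** * Real parts of eigenvalues and the Hermitian part *)

Section Spectra.
Local Open Scope sesquilinear_scope.

Variable R : realType.
Local Notation C := R[i].
Implicit Types (n : nat) (z : C).

Lemma conj_average z : 2^-1 * (z + Num.conj z) = (complex.Re z)%:C.
Proof. by rewrite [z + _]addcJ mulrA mulVf ?mul1r // pnatr_eq0. Qed.

Lemma eq_prod_XsubC_perm n (f g : 'I_n -> C) :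
  \prod_(i < n) ('X - (f i)%:P) = \prod_(i < n) ('X - (g i)%:P) ->
  exists s : 'S_n, forall i, f i = g (s i).
Proof.
pose tup (h : 'I_n -> C) := [tuple h i | i < n].
have tupE h : \prod_(i < n) ('X - (h i)%:P) = \prod_(z <- tup h) ('X - z%:P).
  by rewrite big_tuple; apply: eq_bigr => i _; rewrite tnth_mktuple.
rewrite !tupE => /prod_XsubC_eq/tuple_permP[s fg]; exists s => i.
have := congr1 (nth 0 ^~ i) fg.
by rewrite -!tnth_nth !tnth_mktuple.
Qed.

Lemma char_poly_unitary_conj n (U A : 'M[C]_n) : U \is unitarymx ->
  char_poly (U *m A *m U ^t*) = char_poly A.
Proof.
move=> Uu; pose lift := map_mx (@polyC C) (m := n) (n := n).
have UV : lift (U ^t*) *m lift U = 1%:M.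
  by rewrite -map_mxM -[X in X *m _]invmx_unitary // mulVmx ?unitarymx_unit ?map_mx1.
rewrite /char_poly /char_poly_mx !map_mxM -/(lift _) -/(lift _) -/(lift _).
have -> : 'X%:M - lift U *m lift A *m lift (U ^t*) =
          lift U *m ('X%:M - lift A) *m lift (U ^t*).
  by rewrite mulmxBr mulmxBl scalar_mxC -(mulmxA _ (lift U)) (mulmx1C UV) mulmx1.
by rewrite !det_mulmx mulrAC -det_mulmx (mulmx1C UV) det1 mul1r.
Qed.

Lemma hermitian_part_hermitian n (A : 'M[C]_n) : hermitian_part A \is hermsymmx.
Proof.
apply/is_hermitianmxP; rewrite expr0 scale1r /hermitian_part.
apply/matrixP => i j; rewrite !mxE rmorphM rmorphD /= conjCK.
by rewrite fmorphV rmorph_nat addrC.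
Qed.

Lemma hermitian_part_unitary_conj n (U A : 'M[C]_n) :
  U *m hermitian_part A *m U ^t* = hermitian_part (U *m A *m U ^t*).
Proof.
rewrite /hermitian_part -scalemxAr -scalemxAl mulmxDr mulmxDl.
congr (_ *: (_ + _)); rewrite !trmx_mul !map_mxM -/(U ^t*) map_trmx trmxK.
by rewrite -map_mx_comp (map_mx_id (@conjCK _)) mulmxA.
Qed.

(** With [T] the Schur form of [A] and [d] the spectrum of the Hermitian part
    [H], the diagonal of the Hermitian part of [T] is that of
    [W *m diag_mx d *m W ^t*], where [W] is unitary.  The doubly stochastic
    matrix consists of the squared moduli of the entries of [W]; the
    permutations [r] and [s] account for the order in which [lamA] and [lamH]
    list the eigenvalues. *)
Lemma Re_eigenvalues_doubly_stochastic n (A : 'M[C]_n) (lamA : 'I_n -> C)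
    (lamH : 'I_n -> R) :
  eigenvalues A lamA ->
  eigenvalues (hermitian_part A) (fun i => (lamH i)%:C) ->
  exists D : 'I_n -> 'I_n -> R,
    [/\ forall i j, 0 <= D i j, forall i, \sum_j D i j = 1,
        forall j, \sum_i D i j = 1 &
        forall i, complex.Re (lamA i) = \sum_j D i j * lamH j].
Proof.
move=> eigA eigH; have [n0|n_gt0] := posnP n.
  by subst n; exists (fun _ _ => 0); split=> // -[].
have [U Uu UA] := Schur A n_gt0.
pose T := U *m A *m U ^t*; have Ttrig : is_trig_mx T.
  by move: UA; rewrite /similar_to conjumx ?unitarymx_unit // invmx_unitary.
have [r rE] : exists r : 'S_n, forall i, T i i = lamA (r i).
  by apply: eq_prod_XsubC_perm; rewrite -char_poly_trig // char_poly_unitary_conj.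
set H := hermitian_part A in eigH.
have Hherm : H \is hermsymmx := hermitian_part_hermitian A.
have HE : H = invmx (spectralmx H) *m diag_mx (spectral_diag H) *m spectralmx H.
  exact/orthomx_spectralP/hermitian_normalmx.
have Vu := spectral_unitarymx H; set V := spectralmx H in HE Vu.
set d := spectral_diag H in HE; rewrite invmx_unitary // in HE.
have Vtu : V ^t* \is unitarymx.
  apply/unitarymxP; rewrite trmxCK -[X in X *m _]invmx_unitary //.
  by rewrite mulVmx ?unitarymx_unit.
have [s sE] : exists s : 'S_n, forall i, d 0 i = (lamH (s i))%:C.
  apply: (eq_prod_XsubC_perm (g := fun i => (lamH i)%:C)).
  rewrite -eigH [in RHS]HE -[V in _ *m V]trmxCK char_poly_unitary_conj //.
  rewrite char_poly_trig; last exact: diag_mx_is_trig.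
  by apply: eq_bigr => i _; rewrite mxE eqxx mulr1n.
pose W := U *m V ^t*; have Wu : W \is unitarymx by apply: mul_unitarymx.
have Wrow i : (W *m W ^t*) i i = 1 by rewrite (unitarymxP Wu) mxE eqxx.
have Wcol i : (W ^t* *m W) i i = 1.
  by rewrite (mulmx1C (unitarymxP Wu)) mxE eqxx.
pose S i j := complex.Re (W i j) ^+ 2 + complex.Im (W i j) ^+ 2.
have SE i j : (S i j)%:C = W i j * (W i j)^*%R by rewrite add_Re2_Im2 normCK.
exists (fun i j => S (r^-1 i)%g (s^-1 j)%g); split.
- by move=> i j; rewrite addr_ge0 ?sqr_ge0.
- move=> i; rewrite (sum_perm (S (r^-1 i)%g)); apply: complexI.
  rewrite rmorph_sum rmorph1 /= -(Wrow (r^-1 i)%g) mxE.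
  by apply: eq_bigr => j _; rewrite SE !mxE.
- move=> j; rewrite (sum_perm (S^~ (s^-1 j)%g)); apply: complexI.
  rewrite rmorph_sum rmorph1 /= -(Wcol (s^-1 j)%g) mxE.
  by apply: eq_bigr => i _; rewrite SE !mxE mulrC.
- move=> i; rewrite -[in LHS](permKV r i) -rE; set l := (r^-1 i)%g.
  apply: complexI; rewrite -conj_average.
  have -> : 2^-1 * (T l l + (T l l)^*%R) = hermitian_part T l l by rewrite !mxE.
  rewrite -hermitian_part_unitary_conj -/H HE.
  have -> : U *m (V ^t* *m diag_mx d *m V) *m U ^t* = W *m diag_mx d *m W ^t*.
    by rewrite /W trmx_mul map_mxM trmxCK !mulmxA.
  rewrite mul_mx_diag mxE rmorph_sum /=.
  rewrite [RHS](reindex_inj (@perm_inj _ s)) /=; apply: eq_bigr => j _.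
  rewrite [X in X * _]mxE [X in _ * X]mxE [W^T _ _]mxE permK sE.
  by rewrite rmorphM /= SE mulrAC.
Qed.
End Spectra.

(** * Zeros of polynomial families and the upper half-plane *)

Section RootPersistence.
Variable R : realType.
Local Notation C := R[i].
Local Notation N := (@ComplexField.Normc.normc R).
Implicit Types (s z : C) (r : R).

(** Connectedness of the unit interval: the supremum of the [r] such that [Q]
    holds on [0, r] satisfies [Q] by closedness, and is 1 by openness. *)
Lemma real_clopen_ind (Q : R -> Prop) :
  (forall r, 0 <= r <= 1 ->
     (forall d, 0 < d -> exists2 r', 0 <= r' <= 1 & `|r' - r| < d /\ Q r') -> Q r) ->
  (forall r, 0 <= r <= 1 -> Q r ->
     exists2 d, 0 < d & forall r', 0 <= r' <= 1 -> `|r' - r| < d -> Q r') ->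
  Q 0 -> Q 1.
Proof.
move=> clQ opQ Q0.
pose E : classical_sets.set R := fun r =>
  0 <= r <= 1 /\ forall r', 0 <= r' <= r -> Q r'.
have E0 : E 0.
  split=> [|r]; first by rewrite lexx ler01.
  by move=> r0; have /eqP <- : 0 == r by rewrite eq_le.
have Eub : classical_sets.ubound E 1 by move=> r [/andP[]].
have Eub' : classical_sets.has_ubound E by exists 1.
have En0 : classical_sets.nonempty E by exists 0.
set t := sup E; have t0 : 0 <= t by apply: ub_le_sup.
have t1 : t <= 1 by apply: ge_sup.
have t01 : 0 <= t <= 1 by rewrite t0 t1.
have Qbelow r : 0 <= r < t -> Q r.
  move=> /andP[r0 rt]; have [e [_ eQ] re] := sup_gt En0 rt.
  by apply: eQ; rewrite r0 ltW.
have Qt : Q t.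
  have [tz|t_pos] := leP t 0.
    by have /eqP -> : t == 0 by rewrite eq_le t0 tz.
  apply: clQ => // d d0; pose r := Num.max 0 (t - d / 2).
  have [rE|rE] : r = 0 \/ r = t - d / 2 by rewrite /r maxEle; case: ifP; [right|left].
  - have := le_max (t - d / 2) 0 (t - d / 2); rewrite lexx orbT -/r rE => td.
    exists 0; first by rewrite lexx ler01.
    by split=> //; rewrite sub0r normrN ger0_norm //; lra.
  - have : 0 <= r by rewrite le_max lexx.
    rewrite rE => r0; exists (t - d / 2); first by apply/andP; split; lra.
    split; last by apply: Qbelow; apply/andP; split; lra.
    by rewrite addrAC subrr add0r normrN ger0_norm; lra.
have [d d0 dQ] := opQ t t01 Qt.
have [->//|tne] := eqVneq 1 t; have {tne}t1' : t < 1 by rewrite lt_neqAle eq_sym tne.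
pose r := Num.min 1 (t + d / 2).
have [r1 rd] : r <= 1 /\ r <= t + d / 2 by rewrite /r !ge_min !lexx orbT.
have tr : t < r by rewrite /r lt_min t1'; lra.
have Er : E r.
  split=> [|r' /andP[r'0 r'r]]; first by rewrite r1 (le_trans t0) // ltW.
  have [r't|tr'] := ltP r' t; first by apply: Qbelow; rewrite r'0.
  apply: dQ; first by rewrite r'0 (le_trans r'r).
  by rewrite ger0_norm; lra.
by have := ub_le_sup Eub' Er; rewrite leNgt tr.
Qed.

Lemma normc_ge0 z : 0 <= N z.
Proof. by case: z => a b; apply: sqrtr_ge0. Qed.

Lemma normc_gt0 z : z != 0 -> 0 < N z.
Proof.
move=> z0; rewrite lt_neqAle normc_ge0 andbT eq_sym.
by apply: contra_neq z0; apply: ComplexField.Normc.eq0_normc.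
Qed.

Lemma le_Im_normc z : `|complex.Im z| <= N z.
Proof. by case: z => a b /=; rewrite -sqrtr_sqr ler_wsqrtr // lerDr sqr_ge0. Qed.

Lemma normc_real r : N r%:C = `|r|.
Proof. by rewrite /= expr0n addr0 sqrtr_sqr. Qed.

Lemma normc_prod (I : finType) (f : I -> C) : N (\prod_i f i) = \prod_i N (f i).
Proof.
exact: (big_morph _ (@ComplexField.Normc.normcM R) (ComplexField.Normc.normc1 R)).
Qed.

(** Over the complex numbers this says that [f] is a polynomial function of
    degree [k] with leading coefficient [c] (for nonzero [c]). *)
Definition factored (k : nat) (c : C) (f : C -> C) :=
  exists z : 'I_k -> C, forall s, f s = c * \prod_i (s - z i).

Definition upper_free (f : C -> C) := forall s, 0 <= complex.Im s -> f s != 0.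

(** A quantitative form of continuity in the parameter [r], uniform in [s]
    relative to the size of a polynomial of degree [d]; the growth bound on
    [g] itself makes the notion stable under products. *)
Definition lipschitz_growth (d : nat) (g : R -> C -> C) := exists2 B, 0 <= B &
  forall r r' s, 0 <= r <= 1 -> 0 <= r' <= 1 ->
  N (g r s) <= B * (1 + N s) ^+ d /\
  N (g r s - g r' s) <= B * `|r - r'| * (1 + N s) ^+ d.

Lemma Im_sub z w : complex.Im (z - w) = complex.Im z - complex.Im w.
Proof. by case: z w => a b [a' b']. Qed.

Lemma upper_free_roots k c (z : 'I_k -> C) f :
  (forall s, f s = c * \prod_i (s - z i)) -> upper_free f ->
  forall i, complex.Im (z i) < 0.
Proof.
move=> fE free i; rewrite ltNge; apply/negP => /free; rewrite fE.
by rewrite (bigD1 i) //= subrr mul0r mulr0 eqxx.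
Qed.

(** All zeros lie below the real axis, hence at distance at least [Im s] from
    [s].  The bound does not depend on the zeros, so it passes to the limit
    along a family. *)
Lemma upper_free_lower_bound k c f s :
  factored k c f -> upper_free f -> 0 <= complex.Im s ->
  N c * complex.Im s ^+ k <= N (f s).
Proof.
move=> [z fE] free s0; have zIm := upper_free_roots fE free.
rewrite fE ComplexField.Normc.normcM normc_prod.
rewrite ler_wpM2l ?normc_ge0 //.
rewrite -[leLHS](_ : \prod_(i < k) complex.Im s = _);
  last by rewrite prodr_const card_ord.
apply: ler_prod => i _; rewrite s0 /=; apply: le_trans (le_Im_normc _).
by rewrite Im_sub; apply: le_trans (ler_norm _); rewrite lerDl oppr_ge0 ltW.
Qed.

(** For a zero [z] below the real axis, the distance from [s] to [z] bounds
    [1 + |s|] up to a factor, both for large [s] by the triangle inequality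
    and for small [s] by the distance of [z] to the axis. *)
Lemma upper_free_coercive k c f :
  c != 0 -> factored k c f -> upper_free f ->
  exists2 e, 0 < e &
    forall s, 0 <= complex.Im s -> e * (1 + N s) ^+ k <= N (f s).
Proof.
move=> c0 [z fE] free; have zIm := upper_free_roots fE free.
(* The factor such that 1 + |s| <= q i * |s - z i| on the half-plane. *)
pose q i := (1 + N (z i)) / - complex.Im (z i) + 1.
have q0 i : 0 < q i.
  by rewrite ltr_wpDl ?ltr01 // divr_ge0 ?addr_ge0 ?normc_ge0 // oppr_ge0 ltW.
exists (N c * \prod_i (q i)^-1) => [|s s0].
  by apply: mulr_gt0; [exact: normc_gt0 | apply: prodr_gt0 => i _; rewrite invr_gt0].
rewrite fE ComplexField.Normc.normcM normc_prod -mulrA.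
rewrite ler_wpM2l ?normc_ge0 //.
rewrite -[_ ^+ k](_ : \prod_(i < k) (1 + N s) = _);
  last by rewrite prodr_const card_ord.
rewrite -big_split /=; apply: ler_prod => i _.
have s1 : 0 <= 1 + N s by rewrite addr_ge0 ?normc_ge0.
rewrite mulr_ge0 ?invr_ge0 ?(ltW (q0 i)) //= ler_pdivrMl //.
have eta : 0 < - complex.Im (z i) by rewrite oppr_gt0.
have dist : - complex.Im (z i) <= N (s - z i).
  apply: le_trans (le_Im_normc _); rewrite Im_sub.
  by apply: le_trans (ler_norm _); rewrite lerDr.
have tri : N s <= N (s - z i) + N (z i).
  by rewrite -[s in leLHS](subrK (z i)) le_normcD.
have : (1 + N (z i)) <= (1 + N (z i)) / - complex.Im (z i) * N (s - z i).
  rewrite mulrAC ler_pdivlMr //; apply: ler_wpM2l => //.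
  by rewrite addr_ge0 ?normc_ge0.
by rewrite /q mulrDl mul1r; lra.
Qed.

Section Family.
Variables (k : nat) (c : C) (F : R -> C -> C).
Hypothesis c0 : c != 0.
Hypothesis Ffac : forall r, 0 <= r <= 1 -> factored k c (F r).
Hypothesis Flip : lipschitz_growth k F.

(** A zero of the limit in the open half-plane would make nearby members small
    there, against [upper_free_lower_bound]. *)
Lemma upper_free_limit r :
  0 <= r <= 1 ->
  (forall d, 0 < d ->
     exists2 r', 0 <= r' <= 1 & `|r' - r| < d /\ upper_free (F r')) ->
  forall s, 0 < complex.Im s -> F r s != 0.
Proof.
move=> r01 near s s0; apply/eqP => Fs.
have [B B0 lip] := Flip; pose M := B * (1 + N s) ^+ k.
have M0 : 0 <= M by rewrite mulr_ge0 ?exprn_ge0 ?addr_ge0 ?normc_ge0.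
pose e := N c * complex.Im s ^+ k.
have e0 : 0 < e by rewrite mulr_gt0 ?normc_gt0 ?exprn_gt0.
(* Adding 1 avoids a division by zero when B = 0. *)
have d0 : 0 < e / (M + 1) by rewrite divr_gt0 // ltr_wpDl.
have [r' r'01 [r'r free]] := near _ d0.
have := upper_free_lower_bound (Ffac r'01) free (ltW s0).
have := (lip r' r s r'01 r01).2; rewrite Fs subr0 -/e mulrAC -/M => up lo.
have := le_trans lo up; rewrite leNgt => /negP[].
apply: le_lt_trans (_ : (M + 1) * `|r' - r| < e).
  by rewrite ler_wpM2r // lerDl.
by rewrite mulrC -ltr_pdivlMr // ltr_wpDl.
Qed.

(** By coercivity a member without zeros in the closed half-plane dominates
    the difference with nearby members, including at large [s]. *)
Lemma upper_free_open r :
  0 <= r <= 1 -> upper_free (F r) ->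
  exists2 d, 0 < d & forall r', 0 <= r' <= 1 -> `|r' - r| < d -> upper_free (F r').
Proof.
move=> r01 free; have [e e0 coer] := upper_free_coercive c0 (Ffac r01) free.
have [B B0 lip] := Flip.
have B1 : 0 < B + 1 by rewrite ltr_wpDl.
exists (e / (B + 1)) => [|r' r'01]; first by rewrite divr_gt0.
rewrite ltr_pdivlMr // => r'r s s0; apply/eqP => Fs.
have := (lip r r' s r01 r'01).2; rewrite Fs subr0 distrC.
move/(le_trans (coer s s0)); rewrite ler_pM2r; last first.
  by rewrite exprn_gt0 // ltr_pwDl ?normc_ge0.
rewrite leNgt => /negP[]; apply: le_lt_trans r'r.
by rewrite mulrC ler_wpM2l // lerDl.
Qed.

(** Zeros cannot cross the real axis, and the degree is constant, so none can
    enter the upper half-plane from infinity. *)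
Lemma upper_free_persists :
  (forall r t, 0 <= r <= 1 -> F r t%:C != 0) -> upper_free (F 0) -> upper_free (F 1).
Proof.
move=> noreal; apply: (real_clopen_ind (Q := fun r => upper_free (F r)));
  last exact: upper_free_open.
move=> r r01 near s; rewrite le_eqVlt => /predU1P[s0|]; last exact: upper_free_limit.
have -> : s = (complex.Re s)%:C by case: s s0 => a b /= <-.
exact: noreal.
Qed.
End Family.

Lemma lipschitz_growth_affine (a b e : C) :
  lipschitz_growth 1 (fun r s => s * a + b + r%:C * e).
Proof.
have [a0 b0 e0] := And3 (normc_ge0 a) (normc_ge0 b) (normc_ge0 e).
exists (N a + N b + N e) => [|r r' s /andP[r0 r1] r'01]; first by rewrite !addr_ge0.
have s0 := normc_ge0 s; rewrite expr1; split.
  apply: (le_trans (le_normcD _ _)); apply: (le_trans (lerD (le_normcD _ _) (lexx _))).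
  rewrite !ComplexField.Normc.normcM normc_real ger0_norm //.
  have re : r * N e <= N e by rewrite ler_piMl.
  by nra.
have -> : s * a + b + r%:C * e - (s * a + b + r'%:C * e) = (r - r')%:C * e.
  by rewrite rmorphB /=; ring.
rewrite ComplexField.Normc.normcM normc_real.
have := normr_ge0 (r - r'); set d := `|_|; move=> d0.
have : 0 <= d * (N a + N b + (N a + N b + N e) * N s).
  by rewrite mulr_ge0 // !addr_ge0 // mulr_ge0 // !addr_ge0.
by lra.
Qed.

Lemma lipschitz_growth_const (a : C) : lipschitz_growth 0 (fun _ _ => a).
Proof.
exists (N a) => [|r r' s _ _]; first exact: normc_ge0.
by rewrite expr0 !mulr1 subrr ComplexField.Normc.normc0 mulr_ge0 ?normc_ge0.
Qed.

Lemma lipschitz_growth0 d : lipschitz_growth d (fun _ _ => 0).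
Proof.
exists 0 => // r r' s _ _.
by rewrite !mul0r subrr ComplexField.Normc.normc0.
Qed.

Lemma lipschitz_growthD d g h :
  lipschitz_growth d g -> lipschitz_growth d h ->
  lipschitz_growth d (fun r s => g r s + h r s).
Proof.
move=> [A A0 gA] [B B0 hB]; exists (A + B) => [|r r' s r01 r'01]; first exact: addr_ge0.
have [[g1 g2] [h1 h2]] := (gA r r' s r01 r'01, hB r r' s r01 r'01).
split; first by rewrite mulrDl; apply: (le_trans (le_normcD _ _)); apply: lerD.
by rewrite opprD addrACA !mulrDl; apply: (le_trans (le_normcD _ _)); apply: lerD.
Qed.

Lemma lipschitz_growthM d e g h :
  lipschitz_growth d g -> lipschitz_growth e h ->
  lipschitz_growth (d + e) (fun r s => g r s * h r s).
Proof.
move=> [A A0 gA] [B B0 hB]; exists (A * B *+ 2) => [|r r' s r01 r'01].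
  by rewrite mulrn_wge0 ?mulr_ge0.
have [[g1 g2] [h1 h2]] := (gA r r' s r01 r'01, hB r r' s r01 r'01).
have [g1' _] := gA r' r s r'01 r01.
have X0 m : 0 <= (1 + N s) ^+ m by rewrite exprn_ge0 // addr_ge0 ?normc_ge0.
rewrite exprD; split.
  rewrite ComplexField.Normc.normcM.
  apply: (le_trans (ler_pM (normc_ge0 _) (normc_ge0 _) g1 h1)).
  rewrite mulrACA ler_wpM2r ?mulr_ge0 // mulr2n lerDl mulr_ge0 //.
have -> : g r s * h r s - g r' s * h r' s =
   (g r s - g r' s) * h r s + g r' s * (h r s - h r' s) by ring.
apply: (le_trans (le_normcD _ _)); rewrite !ComplexField.Normc.normcM.
apply: (le_trans (lerD (ler_pM (normc_ge0 _) (normc_ge0 _) g2 h1)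
                       (ler_pM (normc_ge0 _) (normc_ge0 _) g1' h2))).
by rewrite mulr2n le_eqVlt; apply/orP; left; apply/eqP; ring.
Qed.

Lemma lipschitz_growth_ext d g h :
  (forall r s, g r s = h r s) -> lipschitz_growth d g -> lipschitz_growth d h.
Proof. by move=> gh [B B0 gB]; exists B => // r r' s; rewrite -!gh; apply: gB. Qed.

End RootPersistence.

(** * Restriction of a homogeneous polynomial to complex lines *)

Section Pencil.
Variables (R : realType) (n : nat).
Local Notation C := R[i].
Implicit Types (P : {mpoly R[n]}) (x y : 'I_n -> R) (u v : 'I_n -> C).

Definition ceval P u : C := mmap (real_complex R) u P.

Lemma ceval_ext P u v : u =1 v -> ceval P u = ceval P v.
Proof.
move=> uv; rewrite /ceval /mmap; apply: eq_bigr => m _; congr (_ * _).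
exact: mmap1_eq.
Qed.

Lemma ceval_real P x : ceval P (fun i => (x i)%:C) = (P.@[x])%:C.
Proof.
rewrite /ceval /mmap mevalE rmorph_sum; apply: eq_bigr => m _.
rewrite rmorphM rmorph_prod; congr (_ * _).
by apply: eq_bigr => i _; rewrite rmorphXn.
Qed.

Lemma ceval_scale k P u (c : C) : P \is k.-homog ->
  ceval P (fun i => c * u i) = c ^+ k * ceval P u.
Proof.
move=> /dhomogP hP; rewrite /ceval /mmap big_distrr /= [LHS]big_seq [RHS]big_seq.
apply: eq_bigr => m m_in; have mk : mdeg m = k := hP m m_in.
rewrite mulrCA -mk mdegE /mmap1 expr_sum -big_split /=; congr (_ * _).
by apply: eq_bigr => i _; rewrite exprMn.
Qed.

Definition pencil P u v : {poly C} :=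
  mmap (fun a : R => a%:C%:P) (fun i => u i *: 'X + (v i)%:P) P.

Lemma horner_pencil P u v t : (pencil P u v).[t] = ceval P (fun i => t * u i + v i).
Proof.
rewrite /pencil /ceval /mmap horner_sum; apply: eq_bigr => m _.
rewrite hornerM hornerC /mmap1 horner_prod; congr (_ * _).
by apply: eq_bigr => i _; rewrite horner_exp !hornerE mulrC.
Qed.

Lemma map_line_poly P x y : map_poly (real_complex R) (line_poly P x y) =
  pencil P (fun i => (x i)%:C) (fun i => (y i)%:C).
Proof.
rewrite /line_poly /pencil /mmap rmorph_sum; apply: eq_bigr => m _.
rewrite rmorphM rmorph_prod /= map_polyC; congr (_ * _).
apply: eq_bigr => i _.
by rewrite rmorphXn rmorphD /= map_polyZ map_polyX map_polyC.
Qed.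

Lemma lipschitz_growth_pencil k P u v w : P \is k.-homog ->
  lipschitz_growth k (fun r s => ceval P (fun i => s * u i + v i + r%:C * w i)).
Proof.
move=> /dhomogP hP; rewrite /ceval /mmap.
have hk m : m \in msupp P -> mdeg m = k by apply: hP.
elim: (msupp P : seq _) hk => [|m ms IH] hk.
  by apply: lipschitz_growth_ext (lipschitz_growth0 _ k) => r s; rewrite big_nil.
pose term r s := (P@_m)%:C * mmap1 (fun i => s * u i + v i + r%:C * w i) m.
apply: lipschitz_growth_ext (lipschitz_growthD (g := term) _ (IH _)) => [r s||m' m'in].
- by rewrite big_cons.
- rewrite -(hk m (mem_head _ _)) -[mdeg m]add0n /term.
  apply: lipschitz_growthM; first exact: lipschitz_growth_const.
  rewrite mdegE /mmap1; elim: (index_enum _) => [|i l IHl].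
    rewrite big_nil; apply: lipschitz_growth_ext (lipschitz_growth_const 1) => r s.
    by rewrite big_nil.
  rewrite big_cons; apply: lipschitz_growth_ext (lipschitz_growthM _ IHl) => [r s|].
    by rewrite [RHS]big_cons.
  elim: (m i) => [|d IHd]; first exact: lipschitz_growth_const.
  have step := lipschitz_growthM (lipschitz_growth_affine (u i) (v i) (w i)) IHd.
  rewrite -add1n; apply: lipschitz_growth_ext step.
  by move=> r s; rewrite exprS.
- by apply: hk; rewrite in_cons m'in orbT.
Qed.

Lemma coef_top_mul (p q : {poly C}) d e : (size p <= d.+1)%N -> (size q <= e.+1)%N ->
  (p * q)`_(d + e) = p`_d * q`_e.
Proof.
move=> pd qe; rewrite coefM (bigD1 (inord d)) //= inordK ?ltnS ?leq_addr //.
rewrite addKn big1 ?addr0 // => i; rewrite -val_eqE /= inordK ?ltnS ?leq_addr // => id'.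
have [di|di] := ltnP d i; first by rewrite [p`_i]nth_default ?mul0r // (leq_trans pd).
have {}id' : (i < d)%N by rewrite ltn_neqAle id'.
rewrite [q`__]nth_default ?mulr0 //; apply: leq_trans qe _.
by move: (nat_of_ord i) id' {di} => j; lia.
Qed.

(** The coefficient of formal degree [d]; it may vanish, so that degrees add
    under products without any condition. *)
Definition has_top d (p : {poly C}) c := (size p <= d.+1)%N /\ p`_d = c.

Lemma has_topM d e p q a b :
  has_top d p a -> has_top e q b -> has_top (d + e) (p * q) (a * b).
Proof.
move=> [pd <-] [qe <-]; split; last exact: coef_top_mul.
apply: leq_trans (size_polyMleq _ _) _; lia.
Qed.

Lemma has_top_pencil k P u v : P \is k.-homog -> has_top k (pencil P u v) (ceval P u).
Proof.
move=> /dhomogP hP; rewrite /pencil /ceval /mmap.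
have hk m : m \in msupp P -> mdeg m = k by apply: hP.
elim: (msupp P : seq _) hk => [|m ms IH] hk.
  by rewrite !big_nil; split; rewrite ?size_poly0 ?coef0.
rewrite !big_cons.
have [|s1 c1] := IH; first by move=> m' m'in; apply: hk; rewrite in_cons m'in orbT.
suff [s2 c2] : has_top k ((P@_m)%:C%:P * mmap1 (fun i => u i *: 'X + (v i)%:P) m)
                 ((P@_m)%:C * mmap1 u m).
  split; last by rewrite coefD c1 c2.
  by apply: leq_trans (size_polyD _ _) _; rewrite geq_max s1 s2.
rewrite -(hk m (mem_head _ _)) -[mdeg m]add0n.
apply: has_topM; first by split; rewrite ?size_polyC_leq1 ?coefC.
rewrite mdegE /mmap1; elim: (index_enum _) => [|i l IHl].
  by rewrite !big_nil; split; rewrite ?size_poly1 ?coef1.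
rewrite !big_cons; apply: has_topM IHl.
elim: (m i) => [|d IHd]; first by split; rewrite ?size_poly1 ?coef1.
rewrite !exprS -add1n; apply: has_topM (IHd).
split; last by rewrite !coefE mulr1 addr0.
apply: leq_trans (size_polyD _ _) _; rewrite geq_max.
rewrite (leq_trans (size_scale_leq _ _)) ?size_polyX //.
by rewrite (leq_trans (size_polyC_leq1 _)).
Qed.

(** By homogeneity the coefficient of degree [k] is the value at [u], so there
    are exactly [k] roots when this value is nonzero. *)
Lemma pencil_factor k P u v : P \is k.-homog -> ceval P u != 0 ->
  exists z : 'I_k -> C, pencil P u v = ceval P u *: \prod_i ('X - (z i)%:P).
Proof.
move=> hP Pu; have [sz top] := has_top_pencil u v hP.
have [r rE] := closed_field_poly_normal (pencil P u v).
have szE : size (pencil P u v) = k.+1.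
  apply/eqP; rewrite eqn_leq sz ltnNge; apply/negP => /(nth_default 0).
  by rewrite top => /eqP; apply/negP.
have szr : size r = k.
  have := congr1 (size \o @polyseq C) rE.
  rewrite /= szE size_scale ?lead_coef_eq0 -?size_poly_gt0 ?szE //.
  by rewrite size_prod_XsubC => -[].
exists (fun i => r`_i); rewrite [LHS]rE /lead_coef szE top.
by rewrite (big_nth 0) szr big_mkord.
Qed.

Lemma ceval_factored k P u v : P \is k.-homog -> ceval P u != 0 ->
  factored k (ceval P u) (fun s => ceval P (fun i => s * u i + v i)).
Proof.
move=> hP Pu; have [z zE] := pencil_factor v hP Pu; exists z => s.
rewrite -horner_pencil zE hornerZ horner_prod; congr (_ * _).
by apply: eq_bigr => i _; rewrite hornerXsubC.
Qed.
End Pencil.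

(** * Hyperbolicity cones *)

Section Garding.
Variables (R : realType) (n k : nat) (P : {mpoly R[n]}).
Hypothesis P_homog : P \is k.-homog.
Local Notation C := R[i].
Implicit Types (a b x y : 'I_n -> R) (s z : C) (t : R).

Local Notation "x %:V" := (fun i => (x i)%:C) (at level 2, format "x %:V").

(** Hyperbolicity in the direction [a], without the sign condition. *)
Definition real_rooted a := forall x z,
  ceval P (fun i => z * (a i)%:C + (x i)%:C) = 0 -> complex.Im z = 0.

(** For a hyperbolic direction this is membership in the hyperbolicity cone
    (see [in_coneP]), in a form that needs no list of eigenvalues. *)
Definition in_cone a x := forall t, 0 <= t -> P.@[fun i => t * a i + x i] != 0.

Lemma hyperbolic_real_rooted a : hyperbolic P a -> real_rooted a.
Proof.
move=> [_ real] x z Pz; apply: (real x); rewrite map_line_poly.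
by apply/rootP; rewrite horner_pencil.
Qed.

Lemma homog_scale x t : P.@[fun i => t * x i] = t ^+ k * P.@[x].
Proof.
apply: complexI; rewrite rmorphM rmorphXn /= -!ceval_real -ceval_scale //.
by apply: ceval_ext => i; rewrite rmorphM.
Qed.

Lemma ceval_real_neq0 x : P.@[x] != 0 -> ceval P (fun i => (x i)%:C) != 0.
Proof. by rewrite ceval_real; apply: contra_neq => /complexI. Qed.

Lemma in_cone_neq0 a x : in_cone a x -> P.@[x] != 0.
Proof.
move=> /(_ 0 (lexx _)); congr (_ != _); apply: meval_eq => i.
by rewrite mul0r add0r.
Qed.

Lemma in_cone_shift a x t : 0 <= t -> in_cone a x -> in_cone a (fun i => t * a i + x i).
Proof.
move=> t0 ax u u0; have := ax (u + t) (addr_ge0 u0 t0); congr (_ != _).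
by apply: meval_eq => i; ring.
Qed.

Lemma ceval_unscale (c : C) (u v : 'I_n -> C) : c != 0 -> (forall i, u i = c * v i) ->
  ceval P v != 0 -> ceval P u != 0.
Proof.
move=> c0 uE Pv; rewrite (@ceval_ext _ _ P u (fun i => c * v i)) //.
by rewrite (ceval_scale _ _ P_homog) mulf_neq0 ?expf_neq0.
Qed.

Lemma eq_real_Re z : complex.Im z = 0 -> z = (complex.Re z)%:C.
Proof. by case: z => ? ? /= ->. Qed.

(** A zero [s] would make [s^-1] a zero of P(t a + b), hence real and, [b]
    being in the cone, negative, against Re s >= 0. *)
Lemma cone_right_half_plane a b s : real_rooted a -> P.@[a] != 0 -> in_cone a b ->
  0 <= complex.Re s -> ceval P (fun i => (a i)%:C + s * (b i)%:C) != 0.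
Proof.
move=> arr Pa ab s0; have [->|sn0] := eqVneq s 0.
  rewrite (@ceval_ext _ _ P _ a%:V); first exact: ceval_real_neq0.
  by move=> i; rewrite mul0r addr0.
apply: (ceval_unscale (v := fun i => s^-1 * (a i)%:C + (b i)%:C) sn0) => [i|].
  by rewrite mulrDr mulrA mulfV // mul1r.
apply/eqP => Pz; have sr := eq_real_Re (arr b s^-1 Pz).
have r0 : 0 <= complex.Re s^-1.
  by case: s {sn0 Pz sr} s0 => p q /= p0; rewrite divr_ge0 // addr_ge0 ?sqr_ge0.
have /negP[] := ab _ r0; apply/eqP/complexI; rewrite -ceval_real -[RHS]Pz.
by apply: ceval_ext => i; rewrite rmorphD rmorphM /= -sr.
Qed.

Lemma Re_mulNi s : complex.Re (- 'i%C * s) = complex.Im s.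
Proof. by case: s => p q /=; ring. Qed.

Lemma complex_i_neq0 : ('i%C : C) != 0.
Proof. by rewrite eq_complex /= oner_eq0 andbF. Qed.

(** The family in [r] replaces [x] by [r x].  For real [s] it has no zero,
    since the number i cannot be a zero of P(t a + y) with [y] real; at
    [r = 0] the statement is [cone_right_half_plane] after division by i. *)
Lemma upper_half_plane_free a b x : real_rooted a -> P.@[a] != 0 -> in_cone a b ->
  upper_free (fun s => ceval P (fun i => s * (b i)%:C + ('i%C * (a i)%:C + (x i)%:C))).
Proof.
move=> arr Pa ab; have Pb := ceval_real_neq0 (in_cone_neq0 ab).
pose F r s := ceval P (fun i => s * (b i)%:C + 'i%C * (a i)%:C + r%:C * (x i)%:C).
have Ffac r : 0 <= r <= 1 -> factored k (ceval P b%:V) (F r).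
  move=> _.
  have [z zE] :=
    ceval_factored (fun i => 'i%C * (a i)%:C + r%:C * (x i)%:C) P_homog Pb.
  exists z => s; rewrite -zE; apply: ceval_ext => i; exact/esym/addrA.
have Flip : lipschitz_growth k F by apply: lipschitz_growth_pencil.
suff F1 : upper_free (F 1).
  move=> s /F1; congr (_ != _); apply: ceval_ext => i.
  by rewrite mul1r addrA.
apply: (upper_free_persists Pb Ffac Flip) => [r t _|s s0].
  apply/eqP => F0; suff /eqP : complex.Im ('i%C : C) = 0 by rewrite oner_eq0.
  apply: (arr (fun i => t * b i + r * x i)); rewrite -[RHS]F0.
  by apply: ceval_ext => i; rewrite rmorphD !rmorphM /=; ring.
apply: (ceval_unscale (v := fun i => (a i)%:C + (- 'i%C * s) * (b i)%:C)
         complex_i_neq0) => [i|].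
  have ii : 'i%C * 'i%C = -1 :> C by rewrite -expr2 sqr_i.
  by rewrite rmorph0 mul0r addr0 mulrDr !mulrA mulrN ii opprK mul1r addrC.
by apply: cone_right_half_plane; rewrite ?Re_mulNi.
Qed.

(** Letting the multiple of [a] in [upper_half_plane_free] tend to 0 excludes
    zeros of P(s b + x) in the open upper half-plane.  The lower half-plane
    follows by changing the signs of [s] and [x]. *)
Lemma real_rooted_cone a b : real_rooted a -> P.@[a] != 0 -> in_cone a b ->
  real_rooted b.
Proof.
move=> arr Pa ab; have Pb := ceval_real_neq0 (in_cone_neq0 ab).
have up x s : 0 < complex.Im s -> ceval P (fun i => s * (b i)%:C + (x i)%:C) != 0.
  pose F r s := ceval P (fun i => s * (b i)%:C + (x i)%:C + r%:C * ('i%C * (a i)%:C)).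
  have Ffac r : 0 <= r <= 1 -> factored k (ceval P b%:V) (F r).
    move=> _.
    have [z zE] :=
      ceval_factored (fun i => (x i)%:C + r%:C * ('i%C * (a i)%:C)) P_homog Pb.
    exists z => s'; rewrite -zE; apply: ceval_ext => i; exact/esym/addrA.
  have Flip : lipschitz_growth k F by apply: lipschitz_growth_pencil.
  move=> s0; suff : F 0 s != 0.
    by congr (_ != _); apply: ceval_ext => i; rewrite mul0r addr0.
  apply: (upper_free_limit Pb Ffac Flip) s0; first by rewrite lexx ler01.
  (* For r > 0, division by [r] reduces to the multiple 1 of [a]. *)
  move=> d d0; pose r := Num.min 1 (d / 2).
  have r0 : 0 < r by rewrite lt_min ltr01 divr_gt0.
  have [r1 rd] : r <= 1 /\ r <= d / 2 by rewrite /r !ge_min !lexx orbT.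
  exists r; first by rewrite r1 ltW.
  split; first by rewrite subr0 gtr0_norm //; lra.
  move=> s' s'0; have rC : r%:C != 0.
    by rewrite -(rmorph0 (real_complex R)) (inj_eq (@complexI _)) gt_eqF.
  pose y i := r^-1 * x i.
  pose v i := (s' / r%:C) * (b i)%:C + ('i%C * (a i)%:C + (y i)%:C).
  apply: (ceval_unscale (v := v) rC) => [i|].
    by rewrite /v /y rmorphM fmorphV /=; field.
  apply: (upper_half_plane_free y arr Pa ab).
  have -> : s' / r%:C = s' * (r^-1)%:C by rewrite fmorphV.
  case: s' {v} s'0 => p q /= q0; rewrite mulr0 add0r mulr_ge0 // invr_ge0 ltW //.
move=> x z Pz; apply/eqP; case: ltgtP => // zIm.
  have zIm' : 0 < complex.Im (- z) by case: z zIm {Pz} => p q /=; rewrite oppr_gt0.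
  have := up (fun i => - x i) _ zIm'.
  rewrite (@ceval_ext _ _ P _ (fun i => -1 * (z * (b i)%:C + (x i)%:C))).
    by rewrite (ceval_scale _ _ P_homog) Pz mulr0 eqxx.
  by move=> i; rewrite rmorphN /=; ring.
by have := up x z zIm; rewrite Pz eqxx.
Qed.

(** Move [x] along the segment from [a], which lies in the cone.  No zero [s]
    is ever purely imaginary: [P] is real rooted in the direction [b], and
    [s = 0] is excluded since the segment avoids the zeros of [P].  Hence no
    zero can enter the right half-plane, and at [a] there is none.  The substitution of - i s for [s] turns the
    right half-plane into the upper one. *)
Lemma cone_combination_free a b x s : real_rooted a -> P.@[a] != 0 ->
  in_cone a b -> in_cone a x -> 0 <= complex.Re s ->
  ceval P (fun i => s * (b i)%:C + (x i)%:C) != 0.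
Proof.
move=> arr Pa ab ax; have Pb := in_cone_neq0 ab.
have brr := real_rooted_cone arr Pa ab.
pose u i := - 'i%C * (b i)%:C; pose w i := (x i)%:C - (a i)%:C.
have Pu : ceval P u != 0.
  apply: (ceval_unscale (v := b%:V) (c := - 'i%C)) => //.
    by rewrite oppr_eq0 complex_i_neq0.
  exact: ceval_real_neq0.
pose F r z := ceval P (fun i => z * u i + (a i)%:C + r%:C * w i).
have Ffac r : 0 <= r <= 1 -> factored k (ceval P u) (F r).
  move=> _; have [z zE] := ceval_factored (fun i => (a i)%:C + r%:C * w i) P_homog Pu.
  exists z => z'; rewrite -zE; apply: ceval_ext => i; exact/esym/addrA.
have Flip : lipschitz_growth k F by apply: lipschitz_growth_pencil.
have ii : 'i%C * 'i%C = -1 :> C by rewrite -expr2 sqr_i.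
move=> s0; suff F1 : upper_free (F 1).
  have : F 1 ('i%C * s) != 0.
    by apply: F1; case: s s0 => p q /=; rewrite mul0r add0r mul1r.
  congr (_ != _); apply: ceval_ext => i.
  transitivity (- ('i%C * 'i%C) * (s * (b i)%:C) + (x i)%:C).
    by rewrite /u /w; ring.
  by rewrite ii; ring.
apply: (upper_free_persists Pu Ffac Flip) => [r t /andP[r0 r1]|z z0].
  have [->|t0] := eqVneq t 0.
    have -> : F r (0%:C) = (P.@[fun i => (1 - r) * a i + r * x i])%:C.
      rewrite -ceval_real; apply: ceval_ext => i.
      by rewrite /w rmorphD !rmorphM rmorphB rmorph1 rmorph0 /=; ring.
    rewrite (inj_eq (@complexI _)) //.
    have [->|rn0] := eqVneq r 0.
      apply: contra_neq Pa => Pa; rewrite -[RHS]Pa; apply: meval_eq => i.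
      by rewrite mul0r addr0 subr0 mul1r.
    have rpos : 0 < r by rewrite lt_neqAle eq_sym rn0.
    have : P.@[fun i => ((1 - r) / r) * a i + x i] != 0.
      by apply: ax; rewrite divr_ge0 // subr_ge0.
    apply: contra_neq => Pr; apply: (mulfI (expf_neq0 k rn0)).
    rewrite mulr0 -homog_scale -[RHS]Pr; apply: meval_eq => i.
    by field.
  apply/eqP => F0; suff : t = 0 by apply/eqP.
  apply: oppr_inj; rewrite oppr0.
  have -> : - t = complex.Im (- 'i%C * t%:C) by rewrite /=; ring.
  apply: (brr (fun i => (1 - r) * a i + r * x i)); rewrite -[RHS]F0.
  apply: ceval_ext => i.
  by rewrite /u /w rmorphD !rmorphM rmorphB rmorph1 /=; ring.
have -> : F 0 z = ceval P (fun i => (a i)%:C + (- 'i%C * z) * (b i)%:C).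
  by apply: ceval_ext => i; rewrite /u rmorph0; ring.
by apply: cone_right_half_plane; rewrite ?Re_mulNi.
Qed.

Lemma real_rooted_eigenvalues a x : real_rooted a -> P.@[a] != 0 ->
  exists lam : 'I_k -> R, hyp_eigenvalues P a x lam.
Proof.
move=> arr Pa; have [z zE] := pencil_factor x%:V P_homog (ceval_real_neq0 Pa).
have zreal i : z i = (complex.Re (z i))%:C.
  apply/eq_real_Re/(arr x); rewrite -horner_pencil zE hornerZ horner_prod.
  by rewrite (bigD1 i) //= hornerXsubC subrr mul0r mulr0.
exists (fun i => - complex.Re (z i)); apply: (map_poly_inj (real_complex R)).
rewrite map_line_poly zE ceval_real map_polyZ rmorph_prod; congr (_ *: _).
apply: eq_bigr => i _.
by rewrite rmorphD /= map_polyX map_polyC /= rmorphN /= -zreal polyCN.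
Qed.

Lemma hyp_eigenvaluesE a x (lam : 'I_k -> R) t : hyp_eigenvalues P a x lam ->
  P.@[fun i => t * a i + x i] = P.@[a] * \prod_i (t + lam i).
Proof.
move=> lamE; rewrite -line_polyE lamE hornerZ horner_prod; congr (_ * _).
by apply: eq_bigr => i _; rewrite !hornerE.
Qed.

Lemma in_coneP a x : real_rooted a -> P.@[a] != 0 -> in_cone a x <-> hyp_cone k P a x.
Proof.
move=> arr Pa; split=> [ax|[lam [lamE lam0]] t t0].
  have [lam lamE] := real_rooted_eigenvalues x arr Pa; exists lam; split=> // i.
  rewrite ltNge -oppr_ge0; apply/negP => /ax; rewrite (hyp_eigenvaluesE _ lamE).
  by rewrite (bigD1 i) //= addNr mul0r mulr0 eqxx.
rewrite (hyp_eigenvaluesE _ lamE) mulf_neq0 //; apply/prodf_neq0 => i _.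
by rewrite gt_eqF // ltr_wpDl.
Qed.

Lemma in_cone_gt0 a x : real_rooted a -> 0 < P.@[a] -> in_cone a x -> 0 < P.@[x].
Proof.
move=> arr Pa /(in_coneP _ arr (lt0r_neq0 Pa))[lam [lamE lam0]].
have <- : P.@[fun i => 0 * a i + x i] = P.@[x].
  by apply: meval_eq => i; rewrite mul0r add0r.
by rewrite (hyp_eigenvaluesE _ lamE) mulr_gt0 // prodr_gt0 // => i _; rewrite add0r.
Qed.

Lemma cone_pair_factor a b x : real_rooted a -> P.@[a] != 0 ->
  in_cone a b -> in_cone a x ->
  exists2 mu : 'I_k -> R, forall i, 0 < mu i &
  forall p q, q != 0 ->
    P.@[fun i => p * b i + q * x i] = P.@[b] * \prod_i (p + q * mu i).
Proof.
move=> arr Pa ab ax; have brr := real_rooted_cone arr Pa ab.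
have Pb := in_cone_neq0 ab.
have bx : in_cone b x.
  move=> t t0; have := cone_combination_free (s := t%:C) arr Pa ab ax t0.
  apply: contra_neq => Pt.
  transitivity (P.@[fun i => t * b i + x i])%:C; last by rewrite Pt.
  rewrite -ceval_real.
  by apply: ceval_ext => i; rewrite rmorphD rmorphM.
have [mu [muE mu0]] := (in_coneP x brr Pb).1 bx.
exists mu => // p q q0.
have -> : P.@[fun i => p * b i + q * x i] = q ^+ k * P.@[fun i => (p / q) * b i + x i].
  by rewrite -homog_scale; apply: meval_eq => i; field.
rewrite (hyp_eigenvaluesE _ muE) mulrCA; congr (_ * _).
rewrite -[q ^+ k](_ : \prod_(i < k) q = _); last by rewrite prodr_const card_ord.
by rewrite -big_split /=; apply: eq_bigr => i _; field.
Qed.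

(** Each factor satisfies (p + q m)(q + p m) - m = p q (m - 1)^2. *)
Lemma average_product_ge1 (mu : 'I_k -> R) p q : 0 <= p -> 0 <= q -> p + q = 1 ->
  (forall i, 0 < mu i) -> \prod_i mu i = 1 ->
  1 <= \prod_i (p + q * mu i) * \prod_i (q + p * mu i).
Proof.
move=> p0 q0 pq mu0 mu1; rewrite -[leLHS]mu1 -big_split /=.
apply: ler_prod => i _; rewrite ltW //=; have m0 := mu0 i.
have -> : q = 1 - p by lra.
have : 0 <= p * (1 - p) * (mu i - 1) ^+ 2.
  by rewrite mulr_ge0 ?sqr_ge0 // mulr_ge0 //; lra.
by rewrite -subr_ge0; congr (_ <= _); ring.
Qed.

(** Both [x] and its transposed copy lie in the cone and have the same value,
    so the factors [mu] have product 1.  The average with weights [p, q] and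
    the one with [q, p] are exchanged by the transposition, hence the value
    squared is bounded by [average_product_ge1]. *)
Lemma symmetric_average_ge a x (i j : 'I_n) p q :
  symmetric_fun P -> (forall s : 'S_n, forall l, a (s l) = a l) ->
  real_rooted a -> 0 < P.@[a] -> in_cone a x -> 0 <= p -> 0 <= q -> p + q = 1 ->
  P.@[x] <= P.@[fun l => p * x l + q * x (tperm i j l)].
Proof.
move=> Psym ainv arr Pa ax p0 q0 pq.
have [qz|qn0] := eqVneq q 0.
  have -> // : P.@[x] = P.@[fun l => p * x l + q * x (tperm i j l)].
  by apply: meval_eq => l; rewrite qz mul0r addr0 (_ : p = 1) ?mul1r //; lra.
have [pz|pn0] := eqVneq p 0.
  rewrite -[leLHS](Psym (tperm i j)).
  have -> // : P.@[fun l => x (tperm i j l)] =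
               P.@[fun l => p * x l + q * x (tperm i j l)].
  by apply: meval_eq => l; rewrite pz mul0r add0r (_ : q = 1) ?mul1r //; lra.
pose y l := x (tperm i j l).
have ay : in_cone a y.
  move=> t t0; have := ax t t0; rewrite -(Psym (tperm i j)); congr (_ != _).
  by apply: meval_eq => l; rewrite ainv.
have Px := in_cone_gt0 arr Pa ax.
have [mu mu0 muE] := cone_pair_factor arr (lt0r_neq0 Pa) ax ay.
have mu1 : \prod_i mu i = 1.
  apply: (mulfI (lt0r_neq0 Px)); rewrite mulr1.
  have := muE 0 1 (oner_neq0 _); rewrite -/(y _) => E.
  have -> : \prod_i mu i = \prod_i (0 + 1 * mu i).
    by apply: eq_bigr => l _; rewrite add0r mul1r.
  rewrite -E -[RHS](Psym (tperm i j)); apply: meval_eq => l.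
  by rewrite mul0r add0r mul1r.
have swap : P.@[fun l => p * x l + q * y l] = P.@[fun l => q * x l + p * y l].
  rewrite -(Psym (tperm i j)); apply: meval_eq => l.
  by rewrite /y tpermK addrC.
have := average_product_ge1 p0 q0 pq mu0 mu1.
have prod_gt0 c d : 0 < c -> 0 < d -> 0 < \prod_i (c + d * mu i).
  by move=> c0 d0; apply: prodr_gt0 => l _; rewrite addr_gt0 ?mulr_gt0.
have {}p0 : 0 < p by rewrite lt_neqAle eq_sym pn0.
have {}q0 : 0 < q by rewrite lt_neqAle eq_sym qn0.
have := swap; rewrite -/(y _) !muE // => /(mulfI (lt0r_neq0 Px)) <-.
have := prod_gt0 _ _ p0 q0; set f := \prod_i _ => f0 ff.
suff f1 : 1 <= f by rewrite ler_peMr // ltW.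
rewrite leNgt; apply/negP => f1; move: ff; rewrite leNgt => /negP[]; nra.
Qed.
End Garding.

(** * Monotonicity under the passage to the Hermitian part *)

Theorem corollary3p2 (R : realType) (n k : nat) (P : {mpoly R[n]})
    (P_homog : P \is k.-homog)
    (P_sym : symmetric_fun P)
    (P_hyp : hyperbolic P ones)
    (A : 'M[R[i]]_n)
    (lamA : 'I_n -> R[i]) (lamA_eig : eigenvalues A lamA)
    (lamH : 'I_n -> R)
    (lamH_eig : eigenvalues (hermitian_part A) (fun i => (lamH i)%:C))
    (lamH_cone : hyp_cone k P ones lamH) :
  hyp_cone k P ones (fun i => complex.Re (lamA i)) /\
  P.@[lamH] <= P.@[fun i => complex.Re (lamA i)].
Proof.
have onesP : 0 < P.@[ones] by case: P_hyp.
have rr := hyperbolic_real_rooted P_hyp.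
have coneP x := in_coneP P_homog x rr (lt0r_neq0 onesP).
have average_ge i j x p q := @symmetric_average_ge _ _ _ _ P_homog ones x i j p q
  P_sym (fun _ _ => erefl) rr onesP.
have [D [D0 Drow Dcol DE]] := Re_eigenvalues_doubly_stochastic lamA_eig lamH_eig.
(* The lower bound is the value at the initial vector, so that it accumulates
   over the averaging steps. *)
pose K y := in_cone P ones y /\ P.@[lamH] <= P.@[y].
suff [inK PK] : K (fun i => complex.Re (lamA i)) by split=> //; apply/coneP.
apply: (averaging_closed_doubly_stochastic _ D0 Drow Dcol DE); last first.
  by split=> //; apply/coneP.
split=> [x y xy [xc xP]|s x [xc xP]|i j c x /andP[c0 c1] [xc xP]].
- split=> [t t0|]; last by rewrite -(meval_eq _ xy).
  by have := xc t t0; congr (_ != _); apply: meval_eq => i; rewrite xy.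
- split=> [t t0|]; last by rewrite P_sym.
  by have := xc t t0; rewrite -(P_sym s).
- have c1' : 0 <= 1 - c by rewrite subr_ge0.
  split=> [t t0|]; last first.
    by apply: le_trans xP (average_ge _ _ _ _ _ xc c1' c0 _); rewrite subrK.
  (* Shifting by [t] commutes with averaging, so positivity of the shifted
     averages, for all [t], is membership in the cone. *)
  have xt := in_cone_shift t0 xc.
  have := average_ge i j _ _ _ xt c1' c0 (subrK _ _).
  move/(lt_le_trans (in_cone_gt0 P_homog rr onesP xt))/lt0r_neq0; congr (_ != _).
  by apply: meval_eq => l; rewrite /ones; ring.
Qed.
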